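(* For every $d$-dimensional state $\rho$, $$C_r(\rho)\le (\log_2 d)\; C_{l_1}(\rho).$$
   Context: Fix the standard basis of $\mathbb{C}^d$. A $d$-dimensional state is a positive semidefinite $d\times d$ complex matrix of trace $1$. For a state $\rho=(\rho_{ij})$, the $l_1$-norm coherence is $C_{l_1}(\rho)=\sum_{i\ne j}|\rho_{ij}|$, and the relative entropy of coherence is $C_r(\rho)=\min_{\delta}S(\rho\|\delta)$ over diagonal states $\delta$, which equals $S(\rho_{\mathrm{diag}})-S(\rho)$, where $\rho_{\mathrm{diag}}$ is the diagonal matrix with the same diagonal as $\rho$ and $S(\rho)=-\mathrm{Tr}(\rho\log_2\rho)$ is the von Neumann entropy (with $0\log_2 0=0$). Here $S(\rho\|\delta)=\mathrm{Tr}(\rho\log_2\rho)-\mathrm{Tr}(\rho\log_2\delta)$ is the quantum relative entropy ($+\infty$ if the support of $\rho$ is not contained in that of $\delta$). *)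

(* Defs.v *)
From mathcomp Require Import all_boot all_order all_algebra.
From mathcomp Require Import complex.
From mathcomp Require Import all_classical all_reals all_analysis.

Set Implicit Arguments.
Unset Strict Implicit.
Unset Printing Implicit Defensive.

Import Order.TTheory GRing.Theory Num.Theory.

Local Open Scope ring_scope.
Local Open Scope complex_scope.
Local Open Scope sesquilinear_scope.
Local Open Scope classical_set_scope.

(* Since [ln] vanishes on nonpositive reals, [log2 0 = 0]. *)
Definition log2 (R : realType) (x : R) : R := ln x / ln 2.

Definition is_state (R : realType) (d : nat) (rho : 'M[R[i]]_d) : Prop :=
  [/\ rho \is hermsymmx,
      forall v : 'cV[R[i]]_d, 0 <= (v ^t* *m rho *m v) 0 0
    & \tr rho = 1].

(* Functional calculus for a Hermitian matrix A: the library's spectral theorem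
   reads A = P^-1 *m diag_mx D *m P, with P := spectralmx A unitary and
   D := spectral_diag A the (real) eigenvalues. *)
Definition hermfun (R : realType) (d : nat) (f : R -> R) (A : 'M[R[i]]_d) :
    'M[R[i]]_d :=
  invmx (spectralmx A)
    *m diag_mx (map_mx (fun z => (f (complex.Re z))%:C) (spectral_diag A))
    *m spectralmx A.

(* On the kernel of A, where log2 A is undefined, log2mx A is 0.  This realizes
   0 log2 0 = 0 in Tr(rho log2 rho), and is harmless in Tr(rho log2 delta) when
   the support of rho is contained in that of delta. *)
Definition log2mx (R : realType) (d : nat) (A : 'M[R[i]]_d) : 'M[R[i]]_d :=
  hermfun (@log2 R) A.

(* The support of a Hermitian matrix is its range, i.e. its column space; the
   transposes are there because [<=] in scope %MS compares row spaces.  Both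
   traces are real for Hermitian arguments, so [complex.Re] only changes type. *)
Definition relative_entropy (R : realType) (d : nat)
    (rho delta : 'M[R[i]]_d) : \bar R :=
  if (rho^T <= delta^T)%MS
  then (complex.Re (\tr (rho *m log2mx rho) - \tr (rho *m log2mx delta)))%:E
  else +oo%E.

Definition incoherent (R : realType) (d : nat) : set 'M[R[i]]_d :=
  [set delta | is_state delta /\ is_diag_mx delta].

(* The minimum over diagonal states, written as an infimum in \bar R; it is
   attained at the diagonal part of rho. *)
Definition rel_entropy_coherence (R : realType) (d : nat)
    (rho : 'M[R[i]]_d) : \bar R :=
  ereal_inf [set relative_entropy rho delta | delta in @incoherent R d].

Definition l1_coherence (R : realType) (d : nat) (rho : 'M[R[i]]_d) : R :=
  \sum_i \sum_(j | i != j) Normc.normc (rho i j).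

(* Main.v *)
(* Write x for the l1-coherence of rho and a_i = sum_j |rho_ij|, so that the a_i
   sum to 1 + x.  Since rho <= diag(a), every eigenpair (l, v) of rho satisfies
   l <v, diag(a)^-1 v> <= 1, and ln t <= t - 1 then yields
   S(rho || diag(a) / (1 + x)) <= log2 (1 + x).  This is at most x log2 d as soon
   as ln d >= 1, that is d >= 3.  For a qubit with diagonal (p, q), eigenvalues
   l <= m and off-diagonal modulus c, one has x = 2c and lm = pq - c^2; writing
   l = t p, concavity of the entropy h gives h(p, q) - h(l, m) <= (1 - t) h(p, q),
   and h(p, q) <= 2 ln 2 sqrt(pq) with (1 - t) sqrt(pq) <= c closes the case. *)
Require Import Defs.
From mathcomp Require Import all_boot all_order all_algebra.
From mathcomp Require Import complex.
From mathcomp Require Import all_classical all_reals all_analysis.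
From mathcomp Require Import ring lra.
Set Implicit Arguments.
Unset Strict Implicit.
Unset Printing Implicit Defensive.
Import Order.TTheory GRing.Theory Num.Theory numFieldNormedType.Exports.
Local Open Scope ring_scope.
Local Open Scope complex_scope.
Local Open Scope sesquilinear_scope.

(** * Logarithm and binary entropy inequalities *)

Lemma ln_le_sub1 (R : realType) (x : R) : 0 < x -> ln x <= x - 1.
Proof. by move=> x0; rewrite -{1}(subrKC 1 x) le_ln1Dx // ltrBrDr addNr. Qed.

(* With z = sqrt (p / q), this is h(p, q) <= 2 ln 2 sqrt(pq) divided by sqrt(pq);
   the left-hand side is nondecreasing in z. *)
Lemma odds_entropy_le (R : realType) (z : R) : 0 < z -> z <= 1 ->
  (z^-1 + z) * ln (1 + z ^+ 2) - 2 * z * ln z <= 2 * ln 2.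
Proof.
move=> z0 z1.
pose M (x : R) := (x^-1 + x) * ln (1 + x ^+ 2) - 2 * x * ln x.
have M1 : M 1 = 2 * ln 2.
  by rewrite /M expr1n invr1 ln1 mulr0 subr0.
have dM (x : R) : 0 < x ->
    is_derive x 1 M ((1 - x ^- 2) * ln (1 + x ^+ 2) - 2 * ln x).
  move=> x0.
  have xn : x != 0 by rewrite gt_eqF.
  have y0 : 0 < 1 + x ^+ 2 by rewrite ltr_wpDr ?sqr_ge0.
  have d1 := @is_derive1_ln R _ y0.
  have d2 := @is_derive1_ln R _ x0.
  have d3 : is_derive x 1 (fun t : R => 1 + t ^+ 2) (2 * x).
    by apply: is_derive_eq; rewrite add0r /GRing.scale /=; ring.
  have d4 := @is_derive1_comp R _ _ x _ _ d1 d3.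
  have d5 : is_derive x 1 (fun t : R => t^-1) (- x ^- 2).
    by have := is_deriveV xn (is_derive_id x 1); rewrite /GRing.scale /= mulr1.
  rewrite /M.
  apply: is_derive_eq.
  rewrite /GRing.scale /=.
  field.
  by rewrite xn gt_eqF.
rewrite -M1 -/(M z).
apply: (@ger0_derive1_le_cc R M z 1) => //.
- by move=> x; rewrite in_itv /= => /andP[/(lt_trans z0) /dM dx _].
- move=> x; rewrite in_itv /= => /andP[/(lt_trans z0) x0 x1].
  rewrite derive1E (@derive_val _ _ _ _ _ _ _ (dM x x0)).
  have x20 : 0 < x ^+ 2 by rewrite exprn_gt0.
  (* As 1 - x^-2 <= 0, the bound ln(1 + x^2) <= x^2 makes the derivative at least x^2 - 1 - 2 ln x,
     which is nonnegative by [le2]. *)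
  have le1 : ln (1 + x ^+ 2) <= x ^+ 2.
    by rewrite le_ln1Dx // (lt_trans _ x20) ?ltrN10.
  have le2 := ln_le_sub1 x20.
  rewrite lnXn // mulr2n in le2.
  have : (x ^- 2 - 1) * ln (1 + x ^+ 2) <= (x ^- 2 - 1) * x ^+ 2.
    by rewrite ler_wpM2l // subr_ge0 invf_ge1 // expr_le1 // ltW.
  rewrite [leRHS]mulrBl mulVf ?gt_eqF // mul1r => le3.
  lra.
- apply: derivable_within_continuous => x; rewrite in_itv /=.
  by move=> /andP[/(lt_le_trans z0) /dM dx _]; exact: ex_derive.
- by rewrite in_itv /= lexx z1.
- by rewrite in_itv /= lexx z1.
Qed.

(** The bound ln t <= t - 1 at t = 5/6 gives ln(6/5) >= 1/6, and (6/5)^6 = 2.985984 lies just below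
    3. *)
Lemma ln_nat_ge1 (R : realType) (d : nat) : (2 < d)%N -> 1 <= ln (d%:R : R).
Proof.
move=> d2.
have := @ln_le_sub1 R (5 / 6) ltac:(lra).
have -> : ln (5 / 6 : R) = - ln (6 / 5).
  by rewrite -lnV ?posrE ?invf_div //; lra.
move=> le6.
have : ln ((6 / 5 : R) ^+ 6) <= ln d%:R.
  rewrite ler_ln ?posrE ?exprn_gt0 ?ltr0n ?(leq_trans _ d2) //.
  have : (3 : R) <= d%:R by rewrite ler_nat.
  by apply: (le_trans _); rewrite !exprS expr0; lra.
rewrite lnXn; last lra.
by rewrite -[_ *+ 6]mulr_natl; lra.
Qed.

Definition xlnx (R : realType) (x : R) := x * ln x.

(** Since p + q = 1, the choice z = sqrt p / sqrt q turns 1 + z^2 into 1 / q; the condition z <= 1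
    is p <= q. *)
Lemma binary_entropy_le (R : realType) (p q : R) : 0 < p -> p <= q ->
  p + q = 1 -> - (xlnx p + xlnx q) <= 2 * ln 2 * Num.sqrt (p * q).
Proof.
move=> p0 pq pq1; have q0 : 0 < q by apply: lt_le_trans pq.
pose a := Num.sqrt p; pose b := Num.sqrt q.
have a0 : 0 < a by rewrite sqrtr_gt0.
have b0 : 0 < b by rewrite sqrtr_gt0.
have pE : p = a ^+ 2 by rewrite sqr_sqrtr // ltW.
have qE : q = b ^+ 2 by rewrite sqr_sqrtr // ltW.
have ab : a / b <= 1 by rewrite ler_pdivrMr // mul1r ler_wsqrtr.
have := odds_entropy_le (divr_gt0 a0 b0) ab.
have -> : 1 + (a / b) ^+ 2 = b ^- 2.
  rewrite expr_div_n -pE -qE -[X in X + _](divff (lt0r_neq0 q0)) -mulrDl.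
  by rewrite (addrC q) pq1 mul1r.
rewrite lnV ?posrE ?exprn_gt0 // lnXn // ln_div ?posrE // invf_div.
rewrite sqrtrM; last exact: ltW.
rewrite -/a -/b /xlnx pE qE !lnXn // => le1.
have ab0 : 0 < a * b by rewrite mulr_gt0.
have := ler_wpM2r (ltW ab0) le1.
have -> : ((b / a + a / b) * - (ln b *+ 2) - 2 * (a / b) * (ln a - ln b)) *
   (a * b) = (b ^+ 2 + a ^+ 2) * - (ln b *+ 2) - 2 * a ^+ 2 * (ln a - ln b).
  by field; rewrite !gt_eqF.
by rewrite -mulrA; lra.
Qed.

(** Convexity of x ln x between 0, where it vanishes, and p: the two sides differ by t p ln t <=
    0. *)
Lemma xlnx_contract (R : realType) (p t : R) : 0 < p -> 0 <= t -> t <= 1 ->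
  xlnx (t * p) <= t * xlnx p.
Proof.
move=> p0; rewrite le_eqVlt => /predU1P[<-|t0] t1.
  by rewrite /xlnx !mul0r.
have tp0 : 0 < t * p by rewrite mulr_gt0.
rewrite /xlnx lnM ?posrE // mulrDr mulrA gerDr.
by rewrite mulr_ge0_le0 ?ln_le0 // ltW.
Qed.

(** Convexity of x ln x between a and 1, where it vanishes. For the mixture b, ln(b / a) <= b / a -
    1 is weighted by t a and ln b <= b - 1 by 1 - t; the right-hand sides then add up to 0. *)
Lemma xlnx_mix1 (R : realType) (a t : R) : 0 < a -> 0 <= t -> t <= 1 ->
  xlnx (t * a + (1 - t)) <= t * xlnx a.
Proof.
move=> a0 t0 t1.
have b0 : 0 < t * a + (1 - t).
  move: t0; rewrite le_eqVlt => /predU1P[<-|t0]; first by lra.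
  by rewrite ltr_wpDr ?mulr_gt0 // subr_ge0.
rewrite /xlnx; set b := t * a + (1 - t) in b0 *.
have : ln (b / a) <= b / a - 1 by rewrite ln_le_sub1 // divr_gt0.
rewrite ln_div ?posrE // => /(ler_wpM2l (mulr_ge0 t0 (ltW a0))).
have -> : t * a * (b / a - 1) = t * b - t * a by field; rewrite gt_eqF.
have lnb : (1 - t) * ln b <= (1 - t) * (b - 1).
  by rewrite ler_wpM2l ?subr_ge0 // ln_le_sub1.
have -> : b * ln b = t * a * ln b + (1 - t) * ln b by rewrite /b; ring.
have : b = t * a + (1 - t) by [].
lra.
Qed.

(** With t = l / p, the pair (l, m) is the mixture t (p, q) + (1 - t) (0, 1), so the two convexity
    bounds reduce the gap to (1 - t) h(p, q). *)
Lemma binary_entropy_gap_ordered (R : realType) (p q l m c : R) :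
  0 < p -> p <= q -> p + q = 1 -> 0 <= l -> l <= m -> l + m = 1 ->
  0 <= c -> l * m = p * q - c ^+ 2 ->
  (xlnx l + xlnx m) - (xlnx p + xlnx q) <= 2 * ln 2 * c.
Proof.
move=> p0 pq pq1 l0 lm lm1 c0 eq.
(* If l > p, then also m > p, whereas (l - p)(m - p) = -c^2. *)
have lp : l <= p.
  rewrite leNgt; apply/negP => pl.
  have qE : q = 1 - p by lra.
  have mE : m = 1 - l by lra.
  have : (l - p) * (m - p) <= 0.
    have -> : (l - p) * (m - p) = - c ^+ 2.
      by rewrite mulrBl !mulrBr eq qE mE; ring.
    by rewrite oppr_le0 sqr_ge0.
  by rewrite pmulr_rle0 ?subr_gt0 //; lra.
pose t := l / p.
have t0 : 0 <= t by rewrite divr_ge0 // ltW.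
have t1 : t <= 1 by rewrite ler_pdivrMr // mul1r.
have lE : l = t * p by rewrite divfK ?gt_eqF.
have mE : m = t * q + (1 - t).
  have -> : m = 1 - l by lra.
  have -> : q = 1 - p by lra.
  by rewrite lE; ring.
have q0 : 0 < q by apply: lt_le_trans pq.
have le1 := xlnx_contract p0 t0 t1.
have le2 := xlnx_mix1 q0 t0 t1.
have le3 := binary_entropy_le p0 pq pq1.
(* After squaring, the slack is t (1 - t) p (q - p), nonnegative because p <= q. *)
have le4 : (1 - t) * Num.sqrt (p * q) <= c.
  rewrite -(ler_pXn2r (n := 2)) ?nnegrE ?mulr_ge0 ?sqrtr_ge0 ?subr_ge0 //.
  rewrite exprMn sqr_sqrtr; last by rewrite mulr_ge0 // ltW.
  have -> : c ^+ 2 = p * q - l * m by lra.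
  have qE : q = 1 - p by lra.
  rewrite mE lE qE -subr_ge0.
  have -> : p * (1 - p) - t * p * (t * (1 - p) + (1 - t)) -
     (1 - t) ^+ 2 * (p * (1 - p)) = t * (1 - t) * p * (q - p).
    by rewrite qE; ring.
  apply: mulr_ge0; rewrite ?subr_ge0 //.
  by rewrite mulr_ge0 ?(ltW p0) // mulr_ge0 ?subr_ge0.
have ln20 : 0 <= ln 2 :> R by rewrite ln_ge0 // ler1n.
rewrite {1}lE {1}mE.
have := ler_wpM2l (_ : 0 <= 1 - t) le3; rewrite subr_ge0 => /(_ t1).
have := ler_wpM2l (mulr_ge0 (ler0n R 2) ln20 : 0 <= 2 * ln 2 :> R) le4.
lra.
Qed.

Lemma binary_entropy_gap (R : realType) (p q l m c : R) :
  0 < p -> 0 < q -> p + q = 1 -> 0 <= l -> 0 <= m -> l + m = 1 ->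
  0 <= c -> l * m = p * q - c ^+ 2 ->
  (xlnx l + xlnx m) - (xlnx p + xlnx q) <= 2 * ln 2 * c.
Proof.
move=> p0 q0 pq l0 m0 lm c0 eq.
wlog lem : l m l0 m0 lm eq / l <= m => [H|].
  have [|/ltW ml] := leP l m; first exact: H.
  rewrite [xlnx l + _]addrC.
  by apply: H => //; [rewrite addrC|rewrite mulrC].
wlog lepq : p q p0 q0 pq eq / p <= q => [H|].
  have [|/ltW qp] := leP p q; first exact: H.
  rewrite [xlnx p + _]addrC.
  by apply: H => //; [rewrite addrC|rewrite [q * p]mulrC].
exact: binary_entropy_gap_ordered eq.
Qed.

(** * Complex moduli and diagonal dominance *)

Lemma normC_normc (R : realType) (z : R[i]) : `|z| = (Normc.normc z)%:C.
Proof. by []. Qed.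

Lemma mul_conj_normc (R : realType) (z : R[i]) :
  (z^* * z)%R = (Normc.normc z ^+ 2)%:C.
Proof. by rewrite mulrC -[LHS]normCK normC_normc rmorphXn. Qed.

Lemma normc_ge0 (R : realType) (z : R[i]) : 0 <= Normc.normc z.
Proof. by rewrite -ler0c -normC_normc. Qed.

Lemma normc_real (R : realType) (x : R) : 0 <= x -> Normc.normc x%:C = x.
Proof.
by move=> x0; apply: (@complexI R); rewrite -normC_normc ger0_norm // ler0c.
Qed.

Lemma normc_conj (R : realType) (z : R[i]) : Normc.normc z^* = Normc.normc z.
Proof. by case: z => x y; rewrite /= sqrrN. Qed.

(** Each term is bounded by 2 N_i N_j <= N_i^2 + N_j^2; by symmetry of r both halves sum to half of
    the row sums against N_i^2. *)
Lemma quadratic_form_le_diag (R : realType) (n : nat)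
    (r : 'I_n -> 'I_n -> R) (a : 'I_n -> R) (N : 'I_n -> R) :
  (forall i j, 0 <= r i j) -> (forall i j, r i j = r j i) ->
  (forall i, \sum_j r i j <= a i) ->
  \sum_i \sum_j N i * r i j * N j <= \sum_i a i * N i ^+ 2.
Proof.
move=> r0 rC ra.
have le1 : \sum_i \sum_j N i * r i j * N j <=
    \sum_i \sum_j (r i j * N i ^+ 2 / 2 + r i j * N j ^+ 2 / 2).
  apply: ler_sum => i _; apply: ler_sum => j _.
  have := mulr_ge0 (r0 i j) (sqr_ge0 (N i - N j)).
  rewrite sqrrB -subr_ge0; lra.
apply: (le_trans le1).
under eq_bigr do rewrite big_split /=.
rewrite big_split /= [X in _ + X]exchange_big /=.
under [X in _ + X]eq_bigr do under eq_bigr do rewrite rC.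
rewrite -big_split /=; apply: ler_sum => i _.
rewrite -big_split /=.
apply: le_trans (_ : (\sum_j r i j) * N i ^+ 2 <= _); last first.
  by rewrite ler_wpM2r ?sqr_ge0.
by rewrite mulr_suml; apply: ler_sum => j _; lra.
Qed.

(** * Spectral data of a state *)

Section Spectral.
Variables (R : realType) (d : nat) (rho : 'M[R[i]]_d).
Hypothesis rho_state : is_state rho.

Let P := spectralmx rho.

Definition eigval (k : 'I_d) : R := complex.Re (spectral_diag rho 0 k).
(** The squared overlap of the k-th eigenvector with the i-th basis vector; these weights carry the
    spectrum to the diagonal of rho. *)
Definition weight (k i : 'I_d) : R := Normc.normc (P k i) ^+ 2.

Let invP : invmx P = P^t*.
Proof. by rewrite invmx_unitary // spectral_unitarymx. Qed.

Let PPt : P *m P^t* = 1%:M.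
Proof. by rewrite -invP mulmxV // spectral_unit. Qed.

Lemma spectral_diagE :
  spectral_diag rho = map_mx (fun z => (complex.Re z)%:C) (spectral_diag rho).
Proof.
case: rho_state => herm _ _; apply/rowP => k; rewrite mxE RRe_real //.
by have /mxOverP := hermitian_spectral_diag_real herm; apply.
Qed.

Lemma state_spectralE : rho = invmx P *m diag_mx (spectral_diag rho) *m P.
Proof. by case: rho_state => /hermitian_normalmx/orthomx_spectralP. Qed.

Lemma normc_state_sym i j : Normc.normc (rho i j) = Normc.normc (rho j i).
Proof.
case: rho_state => /is_hermitianmxP; rewrite expr0 scale1r => e _ _.
rewrite [in LHS]e !mxE; apply: (@complexI R).
by rewrite -!normC_normc -[LHS]norm_conjC conjCK.
Qed.

Lemma quadratic_form_eigval (w : 'cV[R[i]]_d) :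
  (w^t* *m rho *m w) 0 0 =
    (\sum_k eigval k * Normc.normc ((P *m w) k 0) ^+ 2)%:C.
Proof.
rewrite [in LHS]state_spectralE invP spectral_diagE; set D := diag_mx _.
have -> : w^t* *m (P^t* *m D *m P) *m w = (P *m w)^t* *m D *m (P *m w).
  by rewrite trmx_mul map_mxM !mulmxA.
rewrite -mulmxA mxE rmorph_sum; apply: eq_bigr => k _.
by rewrite mul_diag_mx !mxE mulrCA rmorphM /= -mul_conj_normc.
Qed.

(** Positivity is tested on the k-th eigenvector, the k-th column of [P^t*]. *)
Lemma eigval_ge0 k : 0 <= eigval k.
Proof.
case: rho_state => _ /(_ (P^t* *m delta_mx k 0)) + _.
rewrite quadratic_form_eigval ler0c mulmxA PPt mul1mx.
rewrite (bigD1 k) //= big1 => [|l lk]; last first.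
  by rewrite mxE (negPf lk) Normc.normc0 expr0n mulr0.
by rewrite mxE !eqxx Normc.normc1 expr1n mulr1 addr0.
Qed.

Lemma sum_weight k : \sum_i weight k i = 1.
Proof.
apply: (@complexI R); rewrite rmorph_sum /=.
have /matrixP/(_ k k) := PPt; rewrite !mxE eqxx => e.
rewrite [RHS](_ : _ = true%:R) // -e.
by apply: eq_bigr => i _; rewrite -mul_conj_normc mulrC !mxE.
Qed.

Lemma diag_state i : rho i i = (\sum_k eigval k * weight k i)%:C.
Proof.
pose e : 'cV[R[i]]_d := delta_mx i 0.
have -> : rho i i = (e^t* *m rho *m e) 0 0.
  by rewrite trmx_delta map_delta_mx -rowE -colE !mxE.
rewrite quadratic_form_eigval; congr (_%:C); apply: eq_bigr => k _.
by rewrite -colE mxE.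
Qed.

Lemma sum_eigval : \sum_k eigval k = 1.
Proof.
case: rho_state => _ _ tr1; apply: (@complexI R).
rewrite [RHS](_ : _ = \tr rho); last by rewrite tr1.
rewrite rmorph_sum /=.
rewrite [in RHS]state_spectralE mxtrace_mulC mulmxA mulmxV ?spectral_unit //.
rewrite mul1mx mxtrace_diag spectral_diagE.
by apply: eq_bigr => k _; rewrite !mxE.
Qed.

Lemma trace_log2mx :
  \tr (rho *m log2mx rho) = (\sum_k eigval k * log2 (eigval k))%:C.
Proof.
rewrite /log2mx /hermfun [X in X *m _]state_spectralE -/P.
rewrite mulmxA mulmxA -[_ *m P *m invmx P]mulmxA mulmxV ?spectral_unit //.
rewrite mulmx1 mxtrace_mulC mulmxA mulmxA mulmxV ?spectral_unit // mul1mx.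
rewrite mulmx_diag mxtrace_diag rmorph_sum; apply: eq_bigr => k _.
by rewrite [in LHS]spectral_diagE !mxE -rmorphM.
Qed.

End Spectral.

(** * Diagonal states as competitors in the infimum *)

Definition real_diag_mx (R : realType) (d : nat) (a : 'I_d -> R) : 'M[R[i]]_d :=
  diag_mx (\row_i (a i)%:C).

Lemma real_diag_herm (R : realType) (d : nat) (a : 'I_d -> R) :
  real_diag_mx a \is hermsymmx.
Proof.
apply: realsym_hermsym.
  by apply/is_hermitianmxP; rewrite expr0 scale1r map_mx_id // tr_diag_mx.
apply/mxOverP => i j; rewrite !mxE.
case: eqP => _; rewrite ?mulr1n ?mulr0n ?real0 //.
by apply/complex_realP; eexists.
Qed.

(** The chosen eigenbasis P of A = diag(a) need not be the standard one. But P A = D P reads P_ki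
    a_i = D_k P_ki, so either P_ki = 0 or a_i = D_k, and the same relation holds after applying f to
    a and D. *)
Lemma hermfun_diag (R : realType) (d : nat) (f : R -> R) (a : 'I_d -> R) :
  hermfun f (real_diag_mx a) = real_diag_mx (f \o a).
Proof.
set A := real_diag_mx a; rewrite /hermfun.
have herm : A \is hermsymmx := real_diag_herm a.
have /orthomx_spectralP eqA := hermitian_normalmx herm.
have unitP := spectral_unit A.
have {eqA} : spectralmx A *m A = diag_mx (spectral_diag A) *m spectralmx A.
  by rewrite {2}eqA !mulmxA mulmxV // mul1mx.
set P := spectralmx A => eqPA.
rewrite -[RHS]mul1mx -(mulVmx unitP) -!mulmxA; congr (_ *m _).
apply/matrixP => k i; rewrite mul_diag_mx mul_mx_diag !mxE /=.
have /matrixP/(_ k i) := eqPA; rewrite mul_diag_mx mul_mx_diag !mxE.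
have [-> _|Pki] := eqVneq (P k i) 0; first by rewrite mulr0 mul0r.
by rewrite mulrC => /(mulIf Pki) <-; rewrite mulrC.
Qed.

Lemma real_diag_incoherent (R : realType) (d : nat) (a : 'I_d -> R) :
  (forall i, 0 <= a i) -> \sum_i a i = 1 -> incoherent (real_diag_mx a).
Proof.
move=> a0 a1; split; last exact: diag_mx_is_diag.
split; first exact: real_diag_herm.
  move=> v; rewrite -mulmxA mxE sumr_ge0 // => k _.
  rewrite mul_diag_mx !mxE mulrCA mulr_ge0 ?ler0c //.
  by rewrite mulrC -normCK exprn_ge0.
rewrite mxtrace_diag; under eq_bigr do rewrite mxE.
by rewrite -rmorph_sum a1.
Qed.

Lemma relative_entropy_diag (R : realType) (d : nat) (rho : 'M[R[i]]_d)
    (a : 'I_d -> R) : is_state rho -> (forall i, 0 < a i) ->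
  relative_entropy rho (real_diag_mx a) =
    (\sum_k eigval rho k * log2 (eigval rho k) -
     \sum_i complex.Re (rho i i) * log2 (a i))%:E.
Proof.
move=> st a0; rewrite /relative_entropy ifT; last first.
  (* Positive entries make the diagonal matrix invertible, so the support condition holds. *)
  apply: submx_full; rewrite row_full_unit unitmx_tr unitmxE det_diag unitfE.
  by apply/prodf_neq0 => i _; rewrite mxE gt_eqF // ltcR.
rewrite trace_log2mx // /log2mx hermfun_diag mul_mx_diag.
congr (_%:E).
have -> : \tr (\matrix_(i, j) (rho i j * (\row_i0 (log2 (a i0))%:C) 0 j)) =
    (\sum_i complex.Re (rho i i) * log2 (a i))%:C.
  rewrite rmorph_sum; apply: eq_bigr => i _.
  by rewrite !mxE (diag_state st i) [RHS]rmorphM.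
by rewrite -rmorphB.
Qed.

Lemma rel_entropy_coherence_le (R : realType) (d : nat) (rho : 'M[R[i]]_d)
    (a : 'I_d -> R) : is_state rho -> (forall i, 0 < a i) -> \sum_i a i = 1 ->
  (rel_entropy_coherence rho <=
    (\sum_k eigval rho k * log2 (eigval rho k) -
     \sum_i complex.Re (rho i i) * log2 (a i))%:E)%E.
Proof.
move=> st a0 a1; rewrite -relative_entropy_diag //.
apply: ereal_inf_lbound; exists (real_diag_mx a) => //.
by apply: real_diag_incoherent => // i; exact: ltW.
Qed.

(** * Bounding the coherence by log2 (1 + x) *)

(** For the eigenvalue l, the vector w below satisfies l s^2 <= <w, rho w> <= <w, diag(a) w> = s:
    the lower bound keeps only the k-th spectral term, the upper one is diagonal dominance. *)
Lemma eigval_le_diag (R : realType) (d : nat) (rho : 'M[R[i]]_d)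
    (a : 'I_d -> R) (k : 'I_d) : is_state rho -> (forall i, 0 < a i) ->
  (forall i, \sum_j Normc.normc (rho i j) <= a i) ->
  eigval rho k * (\sum_i weight rho k i / a i) <= 1.
Proof.
move=> st a0 ra; set s := \sum_i _.
pose P := spectralmx rho.
have s0 : 0 <= s.
  by apply: sumr_ge0 => i _; rewrite divr_ge0 ?sqr_ge0 // ltW.
(* Test rho <= diag(a) on w = diag(a)^-1 v, with v the k-th eigenvector. *)
pose w : 'cV[R[i]]_d := \col_i ((P k i)^* / (a i)%:C).
have Pw : (P *m w) k 0 = s%:C.
  rewrite mxE rmorph_sum; apply: eq_bigr => i _.
  by rewrite !mxE mulrA [P k i * _]mulrC mul_conj_normc -fmorphV -rmorphM.
have wN i : Normc.normc (w i 0) ^+ 2 = weight rho k i / a i ^+ 2.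
  rewrite mxE Normc.normcM exprMn Normc.normcV exprVn.
  by rewrite normc_conj normc_real ?ltW.
have lower : eigval rho k * s ^+ 2 <=
    \sum_l eigval rho l * Normc.normc ((P *m w) l 0) ^+ 2.
  rewrite (bigD1 k) //= Pw.
  rewrite normc_real // lerDl sumr_ge0 // => l _.
  by rewrite mulr_ge0 ?eigval_ge0 ?sqr_ge0.
have upper : \sum_l eigval rho l * Normc.normc ((P *m w) l 0) ^+ 2 <=
    \sum_i \sum_j Normc.normc (w i 0) * Normc.normc (rho i j) *
      Normc.normc (w j 0).
  rewrite -lecR.
  apply: (le_trans (real_ler_norm _)); first by apply/complex_realP; eexists.
  rewrite -quadratic_form_eigval // -mulmxA mxE rmorph_sum.
  apply: (le_trans (ler_norm_sum _ _ _)); apply: ler_sum => i _.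
  rewrite [(rho *m w) i 0]mxE mulr_sumr rmorph_sum.
  apply: (le_trans (ler_norm_sum _ _ _)); apply: ler_sum => j _.
  by rewrite [(w^t*) 0 i]mxE [w^T _ _]mxE mulrA !normrM norm_conjC !rmorphM.
have := quadratic_form_le_diag (fun i => Normc.normc (w i 0))
  (fun i j => normc_ge0 (rho i j)) (normc_state_sym st) ra.
have -> : \sum_i a i * Normc.normc (w i 0) ^+ 2 = s.
  apply: eq_bigr => i _; rewrite wN; field.
  by rewrite gt_eqF.
move=> /(le_trans upper) /(le_trans lower).
move: s0; rewrite le_eqVlt => /predU1P[<-|s0]; first by rewrite mulr0 ler01.
by rewrite expr2 mulrA ger_pMl.
Qed.

(** Both sides are Tr(rho^2). For a qubit this yields the product of the eigenvalues without
    determinants. *)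
Lemma sum_eigval_sqr (R : realType) (d : nat) (rho : 'M[R[i]]_d) :
  is_state rho ->
  \sum_k eigval rho k ^+ 2 = \sum_i \sum_j Normc.normc (rho i j) ^+ 2.
Proof.
move=> st; case: (st) => /is_hermitianmxP + _ _; rewrite expr0 scale1r => herm.
apply: (@complexI R); rewrite !rmorph_sum /=.
transitivity (\tr (rho *m rho)).
  rewrite [in RHS](state_spectralE st) -!mulmxA mxtrace_mulC !mulmxA.
  rewrite mulmxK ?spectral_unit // mulmxK ?spectral_unit //.
  rewrite mulmx_diag mxtrace_diag; apply: eq_bigr => k _.
  by rewrite (spectral_diagE st) !mxE -rmorphM.
apply: eq_bigr => i _; rewrite mxE rmorph_sum; apply: eq_bigr => j _.
by rewrite {1}herm !mxE [LHS]mul_conj_normc (normc_state_sym st j i).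
Qed.

Lemma sum_diag_state (R : realType) (d : nat) (rho : 'M[R[i]]_d) :
  is_state rho -> \sum_i complex.Re (rho i i) = 1.
Proof.
move=> st; apply: (@complexI R); rewrite rmorph_sum /=.
case: (st) => _ _ tr1; rewrite [RHS](_ : _ = \tr rho); last by rewrite tr1.
by apply: eq_bigr => i _; rewrite (diag_state st i).
Qed.

Lemma coherence_le_log2_sum (R : realType) (d : nat) (rho : 'M[R[i]]_d)
    (a : 'I_d -> R) : is_state rho -> (forall i, 0 < a i) ->
  (forall i, \sum_j Normc.normc (rho i j) <= a i) ->
  (rel_entropy_coherence rho <= (log2 (\sum_i a i))%:E)%E.
Proof.
move=> st a0 ra; set A := \sum_i a i.
(* The index set is nonempty, since the eigenvalues sum to 1; hence A > 0. *)
have [i0|d0] := pselect (exists i : 'I_d, True); last first.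
  have := sum_eigval st; rewrite big1 => [/esym/eqP|k].
    by rewrite oner_eq0.
  by case: d0; exists k.
have A0 : 0 < A.
  case: i0 => i _; rewrite /A (bigD1 i) //= ltr_pwDl // sumr_ge0 // => j _.
  exact: ltW.
have sumA : \sum_i a i / A = 1 by rewrite -mulr_suml divff // gt_eqF.
apply: le_trans (rel_entropy_coherence_le st _ sumA) _ => [i|].
  exact: divr_gt0.
rewrite lee_fin /log2.
have ln2 : 0 < ln 2 :> R by rewrite ln_gt0 // ltr1n.
(* Diagonal entries are expanded over the spectrum, so that both terms become averages over pairs
   (k, i); the normalisation by A splits off as ln A. *)
have -> : \sum_k eigval rho k * (ln (eigval rho k) / ln 2) -
    \sum_i complex.Re (rho i i) * (ln (a i / A) / ln 2) =
  (\sum_k eigval rho k * (\sum_i weight rho k i *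
     (ln (eigval rho k) - ln (a i))) + ln A) / ln 2.
  have -> : \sum_i complex.Re (rho i i) * (ln (a i / A) / ln 2) =
      (\sum_i complex.Re (rho i i) * ln (a i) - ln A) / ln 2.
    rewrite -[ln A in RHS]mul1r -(sum_diag_state st) mulr_suml -sumrB mulr_suml.
    by apply: eq_bigr => i _; rewrite ln_div ?posrE //; ring.
  have -> : \sum_i complex.Re (rho i i) * ln (a i) =
      \sum_k eigval rho k * (\sum_i weight rho k i * ln (a i)).
    under [RHS]eq_bigr do rewrite mulr_sumr.
    rewrite exchange_big; apply: eq_bigr => i _ /=.
    rewrite (diag_state st) /= mulr_suml.
    by apply: eq_bigr => k _; rewrite mulrA.
  under [X in X - _]eq_bigr do rewrite mulrA.
  rewrite -mulr_suml -mulrBl opprB addrA; congr (_ / _).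
  rewrite addrAC -sumrB; congr (_ + _); apply: eq_bigr => k _.
  rewrite -mulrBr; congr (_ * _).
  under [RHS]eq_bigr do rewrite mulrBr.
  by rewrite sumrB -mulr_suml sum_weight // mul1r.
rewrite ler_pM2r ?invr_gt0 // gerDr sumr_le0 // => k _.
(* A zero eigenvalue contributes nothing; the logarithm is compared only for positive ones. *)
have := eigval_ge0 st k; rewrite le_eqVlt => /predU1P[<-|l0].
  by rewrite mul0r.
rewrite pmulr_rle0 //.
apply: le_trans (_ : \sum_i weight rho k i * (eigval rho k / a i - 1) <= 0).
  apply: ler_sum => i _; rewrite ler_wpM2l ?sqr_ge0 //.
  by rewrite -ln_div ?posrE // ln_le_sub1 // divr_gt0.
under eq_bigr do rewrite mulrBr mulr1 mulrCA.
by rewrite sumrB sum_weight // -mulr_sumr subr_le0 eigval_le_diag.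
Qed.

Lemma diag_state_ge0 (R : realType) (d : nat) (rho : 'M[R[i]]_d) i :
  is_state rho -> 0 <= complex.Re (rho i i).
Proof.
move=> st; rewrite (diag_state st) sumr_ge0 // => k _.
by rewrite mulr_ge0 ?eigval_ge0 ?sqr_ge0.
Qed.

Lemma normc_diag_state (R : realType) (d : nat) (rho : 'M[R[i]]_d) i :
  is_state rho -> Normc.normc (rho i i) = complex.Re (rho i i).
Proof.
move=> st; have := diag_state_ge0 i st.
by rewrite (diag_state st) /= => /normc_real.
Qed.

Lemma sum_normc_state (R : realType) (d : nat) (rho : 'M[R[i]]_d) :
  is_state rho ->
  \sum_i \sum_j Normc.normc (rho i j) = 1 + l1_coherence rho.
Proof.
move=> st; rewrite -(sum_diag_state st) /l1_coherence -big_split /=.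
apply: eq_bigr => i _; rewrite (bigD1 i) //= normc_diag_state //.
by under eq_bigl do rewrite eq_sym.
Qed.

Lemma l1_coherence_ge0 (R : realType) (d : nat) (rho : 'M[R[i]]_d) :
  0 <= l1_coherence rho.
Proof. by apply: sumr_ge0 => i _; apply: sumr_ge0 => j _; exact: normc_ge0. Qed.

Lemma coherence_le_log2 (R : realType) (d : nat) (rho : 'M[R[i]]_d) :
  is_state rho ->
  (rel_entropy_coherence rho <= (log2 (1 + l1_coherence rho))%:E)%E.
Proof.
move=> st; set x := l1_coherence rho; have x0 : 0 <= x := l1_coherence_ge0 rho.
have ln2 : 0 < ln 2 :> R by rewrite ln_gt0 // ltr1n.
apply/lee_addgt0Pr => e e0; rewrite -EFinD.
(* The perturbation keeps delta invertible when some row of rho vanishes. *)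
pose eps := e * ln 2 / d.+1%:R.
have eps0 : 0 < eps by rewrite divr_gt0 ?mulr_gt0 ?ltr0n.
pose a i := \sum_j Normc.normc (rho i j) + eps.
have a0 i : 0 < a i.
  by rewrite ltr_wpDl // sumr_ge0 // => j _; exact: normc_ge0.
apply: le_trans (coherence_le_log2_sum st a0 _) _ => [i|].
  by rewrite lerDl ltW.
rewrite lee_fin big_split /= sum_normc_state // -/x sumr_const card_ord.
have y0 : 0 <= eps *+ d by rewrite mulrn_wge0 // ltW.
(* The denominator [d.+1] in [eps] is never zero and keeps the total perturbation within e ln 2. *)
have y1 : eps *+ d <= e * ln 2.
  rewrite -mulr_natr /eps mulrAC ler_pdivrMr ?ltr0n //.
  by rewrite ler_wpM2l ?ler_nat // ltW // mulr_gt0.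
have x1 : 0 < 1 + x by rewrite ltr_pwDl.
rewrite /log2 ler_pdivrMr // mulrDl divfK ?gt_eqF //.
(* Factoring out 1 + x leaves ln(1 + y / (1 + x)) <= y / (1 + x) <= y for the perturbation y. *)
have -> : 1 + x + eps *+ d = (1 + x) * (1 + eps *+ d / (1 + x)).
  by rewrite mulrDr mulr1 mulrC divfK // gt_eqF.
have z0 : 0 <= eps *+ d / (1 + x) by rewrite divr_ge0 // ltW.
rewrite lnM ?posrE ?ltr_pwDl // lerD2l.
apply: le_trans (le_ln1Dx _) _; first by rewrite (lt_le_trans _ z0) // ltrN10.
rewrite ler_pdivrMr //; apply: (le_trans y1); rewrite ler_peMr ?lerDl //.
by rewrite mulr_ge0 // ltW.
Qed.

(** * Qubits and the conclusion *)

(** For 0 < x < 1 one has log2 (1 + x) > x, so the general bound is too weak here; the competitor is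
    the diagonal part of rho instead. *)
Lemma qubit_coherence_le (R : realType) (rho : 'M[R[i]]_2) :
  is_state rho -> 0 < l1_coherence rho ->
  (rel_entropy_coherence rho <= (l1_coherence rho)%:E)%E.
Proof.
move=> st; pose o1 : 'I_2 := lift ord0 ord0.
pose c := Normc.normc (rho ord0 o1).
have c0 : 0 <= c := normc_ge0 _.
have cC : Normc.normc (rho o1 ord0) = c by rewrite normc_state_sym.
have -> : l1_coherence rho = 2 * c.
  rewrite /l1_coherence; under eq_bigr do rewrite big_mkcond.
  by rewrite !big_ord_recl !big_ord0 /= -/o1 cC -/c; ring.
rewrite pmulr_rgt0 // => cp.
have ln2 : 0 < ln 2 :> R by rewrite ln_gt0 // ltr1n.
pose p i := complex.Re (rho i i).
have := sum_eigval_sqr st; have := sum_eigval st; have := sum_diag_state st.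
rewrite !big_ord_recl !big_ord0 /= -/o1 !addr0 cC !(normc_diag_state _ st) -/c.
rewrite -/(p ord0) -/(p o1).
set l := eigval rho ord0; set m := eigval rho o1 => p1 l1 sq.
have l0 : 0 <= l := eigval_ge0 st _.
have m0 : 0 <= m := eigval_ge0 st _.
(* Both pairs sum to 1, so their products are compared through the sums of squares, which differ by
   2 c^2. *)
have lm : l * m = p ord0 * p o1 - c ^+ 2.
  have := congr1 (fun t => t ^+ 2) p1; have := congr1 (fun t => t ^+ 2) l1.
  rewrite !sqrrD; lra.
(* As c > 0, both diagonal entries are positive and the diagonal part of rho is invertible. *)
have pp : 0 < p ord0 * p o1.
  have -> : p ord0 * p o1 = l * m + c ^+ 2 by lra.
  by rewrite ltr_wpDl ?mulr_ge0 ?exprn_gt0.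
have pge0 i : 0 <= p i := diag_state_ge0 i st.
have p00 : 0 < p ord0.
  by rewrite lt0r pge0 andbT; apply: contraTneq pp => ->; rewrite mul0r ltxx.
have p10 : 0 < p o1.
  by rewrite lt0r pge0 andbT; apply: contraTneq pp => ->; rewrite mulr0 ltxx.
have p0 i : 0 < p i.
  by have [j ->|->] := unliftP ord0 i; rewrite ?(ord1 j).
apply: le_trans (rel_entropy_coherence_le st p0 (sum_diag_state st)) _.
rewrite lee_fin !big_ord_recl !big_ord0 -/o1 !addr0 -/(p ord0) -/(p o1) -/l -/m.
have key : xlnx l + xlnx m - (xlnx (p ord0) + xlnx (p o1)) <= 2 * ln 2 * c.
  exact: binary_entropy_gap lm.
rewrite /log2 !mulrA -!mulrDl -mulrBl ler_pdivrMr //.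
by rewrite [leRHS]mulrAC.
Qed.

Theorem proposition6 (R : realType) (d : nat) (rho : 'M[R[i]]_d)
    (rho_state : is_state rho) :
  (rel_entropy_coherence rho <= (log2 d%:R * l1_coherence rho)%:E)%E.
Proof.
have x0 := l1_coherence_ge0 rho.
have ln2 : 0 < ln 2 :> R by rewrite ln_gt0 // ltr1n.
(* Nonzero coherence is needed for the qubit case and also excludes d <= 1. *)
have [xE|xn0] := eqVneq (l1_coherence rho) 0.
  apply: le_trans (coherence_le_log2 rho_state) _.
  by rewrite lee_fin xE addr0 mulr0 /log2 ln1 mul0r.
have xp : 0 < l1_coherence rho by rewrite lt0r xn0.
case: d => [|[|[|d]]] in rho rho_state x0 xn0 xp *.
- by move: xn0; rewrite /l1_coherence big_ord0 eqxx.
- move: xn0; rewrite /l1_coherence big_ord1 big_pred0 ?eqxx // => j.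
  by rewrite !ord1 eqxx.
- rewrite /log2 divff ?gt_eqF // mul1r; exact: qubit_coherence_le.
apply: le_trans (coherence_le_log2 rho_state) _.
rewrite lee_fin /log2 mulrAC ler_pM2r ?invr_gt0 //.
(* For d >= 3, ln(1 + x) <= x <= x ln d. *)
apply: le_trans (le_ln1Dx _) _; first by rewrite (lt_le_trans _ x0) // ltrN10.
by rewrite ler_peMl // ln_nat_ge1.
Qed.
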